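(* Let $\mathcal{H}$ be a finite dimensional real or complex inner product space with inner product $(\cdot,\cdot)$, and let $\mathcal{X}$ and $\mathcal{Y}$ be subspaces of $\mathcal{H}$ with $\dim\mathcal{X}\le\dim\mathcal{Y}$ and $\Theta(\mathcal{X},\mathcal{Y})<\pi/2$ (component-wise). Let the linear operator $A:\mathcal{H}\to\mathcal{H}$ be Hermitian and positive definite, $A>0$, let $\mathcal{X}$ be $A$-invariant and correspond to the contiguous set of the smallest eigenvalues of $A$, let $\Lambda_{\dim\mathcal{X}}\left((P_{\mathcal{Y}}A)|_{\mathcal{Y}}\right)$ denote the vector of the $\dim\mathcal{X}$ (counting the multiplicities) smallest eigenvalues of $(P_{\mathcal{Y}}A)|_{\mathcal{Y}}$, and let $\Theta_A(\mathcal{X},\mathcal{Y})$ denote the vector of angles from $\mathcal{X}$ to $\mathcal{Y}$ defined in the $A$-based scalar product $(x,y)_A=(x,Ay)$. Then $$0\le 1-\frac{\Lambda\left((P_{\mathcal{X}}A)|_{\mathcal{X}}\right)}{\Lambda_{\dim\mathcal{X}}\left((P_{\mathcal{Y}}A)|_{\mathcal{Y}}\right)}\le\max\left\{\sin^2\Theta_A(\mathcal{X},\mathcal{Y})\right\},$$ $$0\le\log\frac{\Lambda_{\dim\mathcal{X}}\left((P_{\mathcal{Y}}A)|_{\mathcal{Y}}\right)}{\Lambda\left((P_{\mathcal{X}}A)|_{\mathcal{X}}\right)}\prec_w\log\left(1+\tan^2\Theta_A(\mathcal{X},\mathcal{Y})\right),$$ $$0\le\frac{\Lambda_{\dim\m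athcal{X}}\left((P_{\mathcal{Y}}A)|_{\mathcal{Y}}\right)}{\Lambda\left((P_{\mathcal{X}}A)|_{\mathcal{X}}\right)}-1\prec_w\tan^2\Theta_A(\mathcal{X},\mathcal{Y}).$$
   Context: For a subspace $\mathcal{Z}$, $P_{\mathcal{Z}}$ is the orthogonal projector onto $\mathcal{Z}$ with respect to $(\cdot,\cdot)$, and $(P_{\mathcal{Z}}A)|_{\mathcal{Z}}$ is the restriction of $P_{\mathcal{Z}}A$ to $\mathcal{Z}$, a Hermitian operator on $\mathcal{Z}$. $\Lambda(\cdot)$ is the vector of eigenvalues of a Hermitian operator, repeated according to multiplicity and arranged in decreasing (i.e. nonincreasing) order; $\Lambda_{\dim\mathcal{X}}$ is likewise arranged in decreasing order. An $A$-invariant subspace $\mathcal{X}$ corresponds to the contiguous set of the smallest eigenvalues of $A$ if the eigenvalues of $A|_{\mathcal{X}}$ are the $\dim\mathcal{X}$ smallest eigenvalues of $A$, counting multiplicities. Principal angles: for $\dim\mathcal{X}\le\dim\mathcal{Y}$, the vector $\Theta(\mathcal{X},\mathcal{Y})$ of $\dim\mathcal{X}$ angles from $\mathcal{X}$ to $\mathcal{Y}$ has components in $[0,\pi/2]$ arranged in decreasing order, and the components of $\cos^2\Theta(\mathcal{X},\mathcal{Y})$ are the eigenvalues of $(P_{\mathcal{X}}P_{\mathcal{Y}})|_{\mathcal{X}}$ arranged in increasing order. $\Theta_A(\mathcal{X},\mathcal{Y})$ is defined in the same way with the projectors orthogonal in the inner product $(\cdot,\cdot)_A$ in place of $P_{\mathcal{X}}$,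 $P_{\mathcal{Y}}$. Functions (including $\log$), quotients and inequalities ($\le$, $<$) of vectors are component-wise; $\max\{\cdot\}$ is the largest component of a vector; a scalar in a vector expression denotes the constant vector. For a real vector $x$, $x^\downarrow$ denotes its rearrangement in decreasing order. For real $n$-vectors, $x\prec_w y$ (weak majorization) means $\sum_{i=1}^k x_i^\downarrow\le\sum_{i=1}^k y_i^\downarrow$ for $k=1,\ldots,n$. *)

(* Defs.v *)
From HB Require Import structures.
From mathcomp Require Import all_boot all_order all_algebra.
From mathcomp Require Import complex.
From mathcomp Require Import classical_sets reals exp trigo.

Set Implicit Arguments.
Unset Strict Implicit.
Unset Printing Implicit Defensive.
Import Order.TTheory GRing.Theory Num.Theory.
Local Open Scope classical_set_scope.
Local Open Scope ring_scope.

Inductive scalar_kind := RealScalars | ComplexScalars.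

Definition scalars (R : realType) (s : scalar_kind) : numFieldType :=
  match s with RealScalars => R | ComplexScalars => R[i] end.

Definition conjugation (R : realType) (s : scalar_kind) :
    {rmorphism scalars R s -> scalars R s} :=
  match s with
  | RealScalars => GRing.RMorphism.clone R R idfun _
  | ComplexScalars => GRing.RMorphism.clone R[i] R[i] Num.conj _
  end.

Definition of_real (R : realType) (s : scalar_kind) :
    {rmorphism R -> scalars R s} :=
  match s with
  | RealScalars => GRing.RMorphism.clone R R idfun _
  | ComplexScalars => GRing.RMorphism.clone R R[i] (real_complex R) _
  end.

Section Operators.
Variables (K : numFieldType) (theta : {rmorphism K -> K}) (H : vectType K).
Variable dot : {dot H for theta}.
Implicit Types (A T : 'End(H)) (Z : {vspace H}).

Definition oproj Z : 'End(H) := daddv_pi Z (orthov dot Z).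

(* [vsproj Z] is the identity on Z, so this is T seen as an endomorphism of Z
   as soon as T maps Z into Z; the choice of [vsproj] off Z is then
   irrelevant. *)
Definition restr T Z : 'End(subvs_of Z) :=
  linfun (vsproj Z \o T \o vsval).

Definition hermitian_op A := forall x y, dot (A x) y = dot x (A y).

Definition posdef_op A := forall x, x != 0 -> 0 < dot x (A x).

Definition opform A of hermitian_op A & posdef_op A := fun x y => dot x (A y).

Section OpForm.
Variables (A : 'End(H)) (hA : hermitian_op A) (pA : posdef_op A).

Fact opform_bilinear :
  bilinear_for (GRing.Scale.Law.clone _ _ *%R _)
    (GRing.Scale.Law.clone _ _ (theta \; *%R) _) (opform hA pA).
Proof.
split=> [y|x] a u v; rewrite /opform.
  by rewrite linearDl linearZl_LR.
by rewrite linearP linearDr linearZr_LR.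
Qed.

HB.instance Definition _ :=
  bilinear_isBilinear.Build K H H K _ _ (opform hA pA) opform_bilinear.

Fact opform_hermitian x y :
  opform hA pA x y = (-1) ^+ false * theta (opform hA pA y x).
Proof. by rewrite /opform -hA hermC. Qed.

HB.instance Definition _ :=
  isHermitianSesquilinear.Build K H false theta (opform hA pA)
    opform_hermitian.

Fact opform_posdef u : u != 0 -> 0 < opform hA pA u u.
Proof. exact: pA. Qed.

HB.instance Definition _ :=
  isDotProduct.Build K H (opform hA pA) opform_posdef.

Definition opdot : {dot H for theta} := opform hA pA.

End OpForm.

End Operators.

Section Spectra.
Variables (R : realType) (K : numFieldType) (iota : {rmorphism R -> K}).

(* The size condition says that the listed eigenvalues exhaust the space, so
   such an s exists exactly when f is diagonalizable with real spectrum (as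
   every Hermitian f is), and it is then unique. *)
Definition is_spectrum (vT : vectType K) (f : 'End(vT)) (s : seq R) :=
  [/\ sorted >=%R s, size s = \dim {:vT} &
      forall a : R, count_mem a s = \dim (passmx.leigenspace f (iota a))].

Definition Lambda (vT : vectType K) (f : 'End(vT)) : seq R :=
  xget [::] [set s | is_spectrum f s].

Definition smallest_entries (k : nat) (s : seq R) : seq R := drop (size s - k) s.

(* [rev] lists the squared cosines increasingly, hence the angles
   decreasingly; acos of a number in [0, 1] lies in [0, pi / 2]. *)
Definition Theta (theta : {rmorphism K -> K}) (H : vectType K)
    (dot : {dot H for theta}) (X Y : {vspace H}) : seq R :=
  [seq acos (Num.sqrt c)
     | c <- rev (Lambda (restr (oproj dot X \o oproj dot Y)%VF X))].

Definition contiguous_smallest (H : vectType K) (A : 'End(H))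
    (X : {vspace H}) :=
  Lambda (restr A X) = smallest_entries (\dim X) (Lambda A).

End Spectra.

Definition decreasing (R : realType) (n : nat) (x : 'I_n -> R) : seq R :=
  sort >=%R (codom x).

Definition weak_majorized (R : realType) (n : nat) (x y : 'I_n -> R) :=
  forall k, (0 < k <= n)%N ->
    \sum_(i < k) (decreasing x)`_i <= \sum_(i < k) (decreasing y)`_i.

(* Main.v *)
Require Import Defs.
From HB Require Import structures.
From mathcomp Require Import all_boot all_order all_algebra.
From mathcomp Require Import complex.
From mathcomp Require Import boolp classical_sets reals sequences exp trigo.
From mathcomp Require Import ring lra zify.

(* In the [A]-inner product let [u_i] be the principal vectors of [X] relative
   to [Y], with cosines squared [c_i].  As [X] is [A]-invariant, it has the same
   orthogonal complement for both inner products, so the map [T] sending [u_i]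
   to [Q u_i / c_i], [Q] the [A]-projection onto [Y], is a right inverse of the
   projection onto [X]: it does not decrease the norm, while it multiplies the
   [A]-norm of [u_i] by [1 / sqrt c_i].  By Courant-Fischer the [dim X] smallest
   Ritz values on [Y] are thus at most the eigenvalues of [A S] on [X], for any
   [S] with [S u_i = s_i u_i] and [s_i >= 1 / c_i = 1 + tan^2 theta_i].  The
   truncation argument of Li and Mathias turns this into the logarithmic
   majorization; the other two claims follow from it, by convexity of the
   exponential and by looking at its first partial sum. *)

Set Implicit Arguments.
Unset Strict Implicit.
Unset Printing Implicit Defensive.
Import Order.TTheory GRing.Theory Num.Theory.
Local Open Scope ring_scope.

(** * Families of reals indexed by ordinals, and their sorting *)

Lemma codom_nth (T : Type) n (a : 'I_n -> T) x (i : 'I_n) : nth x (codom a) i = a i.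
Proof. by rewrite (nth_map i) ?size_enum_ord // nth_ord_enum. Qed.

Lemma sorted_codom (R : realDomainType) n (a : 'I_n -> R) :
  (forall i j : 'I_n, (i <= j)%N -> a j <= a i) -> sorted >=%R (codom a).
Proof.
move=> aS; apply/(sortedP 0) => i; rewrite size_codom card_ord => lt_i1n.
have lt_in := ltnW lt_i1n.
rewrite (codom_nth a 0 (Ordinal lt_i1n)) (codom_nth a 0 (Ordinal lt_in)).
exact: aS.
Qed.

(** Sorting the indices instead of the values lets eigenvectors be carried along when their
    eigenvalues are reordered. *)
Lemma sort_perm (R : realDomainType) n (a : 'I_n -> R) :
  exists2 p : 'I_n -> 'I_n, injective p &
    forall i j : 'I_n, (i <= j)%N -> a (p j) <= a (p i).
Proof.
pose r := relpre a >=%R; pose t := sort r (enum 'I_n).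
have st : size t = n by rewrite size_sort size_enum_ord.
exists (fun i => nth i t i) => [i j|i j ij].
  rewrite (set_nth_default i) ?st // => /eqP.
  by rewrite nth_uniq ?st ?sort_uniq ?enum_uniq // => /eqP/val_inj.
rewrite (set_nth_default i) ?st //.
have rtr : transitive r by move=> x y z /= yx xz; apply: le_trans xz yx.
have rtot : total r by move=> x y; apply: le_total.
have := sorted_leq_nth rtr (fun=> lexx _) i (sort_sorted rtot (enum 'I_n)).
by move/(_ i j); rewrite !inE !st !ltn_ord => /(_ isT isT ij).
Qed.

Lemma card_ord_lt n k : (k <= n)%N -> #|[pred i : 'I_n | (i < k)%N]| = k.
Proof.
by move=> kn; rewrite -sum1_card (big_ord_narrow kn) /= sum1_card card_ord.
Qed.

(** * Order and conjugation, uniformly for real and complex scalars *)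

Section Scalars.
Variables (R : realType) (s : scalar_kind).
Local Notation K := (scalars R s).
Local Notation theta := (conjugation R s).
Local Notation iota := (of_real R s).

Lemma of_real_le (x y : R) : (iota x <= iota y) = (x <= y).
Proof. by case: s => //=; rewrite lecR. Qed.

Lemma conj_of_real (x : R) : theta (iota x) = iota x.
Proof. by case: s => //=; rewrite conj_Creal ?complex_real. Qed.

Lemma ge0_of_real (z : K) : 0 <= z -> exists x : R, z = iota x.
Proof.
case: s z => /= z z0; first by exists z.
by case/complex_realP: (ger0_real z0) => x ->; exists x.
Qed.

Lemma mul_conj_ge0 (z : K) : 0 <= z * theta z.
Proof.
case: s z => /= z; first exact: sqr_ge0.
exact: mul_conjC_ge0.
Qed.

End Scalars.

(** * Elementary rules for inner products *)

Section DotProduct.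
Variables (K : numFieldType) (theta : {rmorphism K -> K}) (V : lmodType K).
Variable dot : {dot V for theta}.

Lemma dot_gt0 v : v != 0 -> 0 < dot v v.
Proof. exact: neq0_dnorm_gt0. Qed.

Lemma dot_ge0 v : 0 <= dot v v.
Proof.
by have [->|/dot_gt0/ltW//] := eqVneq v 0; rewrite linear0l.
Qed.

Lemma dot_eq0 v : (dot v v == 0) = (v == 0).
Proof.
by have [->|/dot_gt0/gt_eqF//] := eqVneq v 0; rewrite linear0l eqxx.
Qed.

Lemma dotC u v : dot u v = theta (dot v u).
Proof. by rewrite hermC expr0 mul1r. Qed.

Lemma dot_sym0 u v : dot u v = 0 -> dot v u = 0.
Proof. by move=> uv; rewrite dotC uv rmorph0. Qed.

Lemma dotZl a u v : dot (a *: u) v = a * dot u v.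
Proof. exact: linearZl_LR. Qed.

Lemma dotZr a u v : dot u (a *: v) = theta a * dot u v.
Proof. exact: linearZr_LR. Qed.

End DotProduct.

Import VectorInternalTheory.

(** * Matrices, determinants and eigenvectors of endomorphisms *)

Section LfunMatrix.
Variables (F : fieldType) (V : vectType F).

Definition lfun_mx (f : 'End(V)) : 'M[F]_(dim V) := lin1_mx (v2r \o f \o r2v).

Lemma lfun_mxE (f : 'End(V)) (z : 'rV[F]_(dim V)) : f (r2v z) = r2v (z *m lfun_mx f).
Proof. by rewrite mul_rV_lin1 /= v2rK. Qed.

Lemma lfun_mx_comp (f g : 'End(V)) :
  lfun_mx (f \o g)%VF = lfun_mx g *m lfun_mx f.
Proof.
apply/row_matrixP => i; rewrite !rowE mulmxA; apply: (can_inj r2vK).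
by rewrite -!lfun_mxE comp_lfunE.
Qed.

(** In a basis of eigenvectors the matrix is diagonal. Passing through determinants makes products
    of eigenvalues multiplicative under composition, even when the factors have different
    eigenbases. *)
Lemma det_lfun_mx n (f : 'End(V)) (e : 'I_n -> V) (a : 'I_n -> F) :
  \dim {:V} = n -> free [tuple e i | i < n] ->
  (forall i, f (e i) = a i *: e i) -> \det (lfun_mx f) = \prod_i a i.
Proof.
rewrite dimvf => dV fre fe; subst n.
pose E := \matrix_i v2r (e i).
have Eu : E \in unitmx.
  rewrite -row_free_unit -kermx_eq0; apply/rowV0P => v /sub_kermxP vE.
  apply/rowP => i; rewrite mxE; move/freeP: fre; apply.
  apply: (can_inj v2rK); rewrite linear0 -vE mulmx_sum_row linear_sum.
  by apply: eq_bigr => j _; rewrite -tnth_nth tnth_mktuple linearZ /= rowK.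
have Ef : E *m lfun_mx f = diag_mx (\row_i a i) *m E.
  apply/row_matrixP => i; rewrite !row_mul rowK row_diag_mx -scalemxAl -rowE.
  by rewrite rowK mxE; apply: (can_inj r2vK); rewrite -lfun_mxE v2rK fe linearZ /= v2rK.
have /(congr1 (mulmx^~ (invmx E))) := Ef; rewrite -mulmxA => EfE.
have : \det (E *m (lfun_mx f)) = \prod_i a i * \det E.
  by rewrite Ef det_mulmx det_diag; congr (_ * _); apply: eq_bigr => i _; rewrite mxE.
rewrite det_mulmx mulrC; apply: mulIf.
by rewrite -unitfE -unitmxE.
Qed.

End LfunMatrix.

(** Over [R[i]] algebraic closedness gives an eigenvector, and symmetry makes its eigenvalue real.
    Over [R] the matrix is complexified: either one of the real and imaginary parts of a complex
    eigenvector vanishes and the other is the eigenvector sought, or symmetry kills the imaginary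
    part of the eigenvalue. *)
Lemma hermitian_eigenvector (R : realType) (s : scalar_kind)
    (V : vectType (scalars R s)) (dot : {dot V for conjugation R s})
    (f : 'End(V)) :
  hermitian_op dot f -> (0 < \dim {:V})%N ->
  exists (a : R) (v : V), v != 0 /\ f v = of_real R s a *: v.
Proof.
case: s V dot f => /= V dot f fH; rewrite dimvf => n_gt0.
  have := eigenvalue_closed (map_mx (real_complex R) (lfun_mx f)) n_gt0.
  case=> c /eigenvalueP[z zc z0].
  pose x := map_mx (@complex.Re R) z; pose y := map_mx (@complex.Im R) z.
  have zE : z = map_mx (real_complex R) x + 'i%C *: map_mx (real_complex R) y.
    by apply/rowP => i; rewrite !mxE -complexE.
  pose v := r2v x; pose w := r2v y.
  pose a := complex.Re c; pose b := complex.Im c.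
  have cE : c = Complex a b by rewrite /a /b; case: (c).
  (* These are the real and imaginary parts of the equation [zc]. *)
  have [xM yM] : x *m lfun_mx f = a *: x - b *: y /\
                 y *m lfun_mx f = b *: x + a *: y.
    split; apply/rowP => i; move/rowP/(_ i): zc;
      rewrite {1}zE mulmxDl -scalemxAl -!map_mxM !mxE {1}cE;
      by case: (z 0 i) => p q; simpc => -[e1 e2]; rewrite /= ?e1 ?e2 // addrC.
  have fv : f v = a *: v - b *: w by rewrite lfun_mxE xM linearB !linearZ.
  have fw : f w = b *: v + a *: w by rewrite lfun_mxE yM linearD !linearZ.
  have [v0|v0] := eqVneq v 0; have [w0|w0] := eqVneq w 0.
  - case/eqP: z0; rewrite zE -[x]r2vK -[y]r2vK -/v -/w v0 w0.
    by rewrite linear0 !map_mx0 scaler0 addr0.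
  - by exists a, w; rewrite fw v0 scaler0 add0r.
  - by exists a, v; rewrite fv w0 scaler0 subr0.
  (* [f (v + i w) = (a + i b) (v + i w)], and symmetry of [f] on [v, w] gives
     [b (|v|^2 + |w|^2) = 0]. *)
  have b0 : b = 0.
    have := fH v w; rewrite fv fw linearBl linearDr !linearZl_LR !linearZr_LR /=.
    move=> /eqP; rewrite subr_eq -subr_eq0 => /eqP e; apply/eqP.
    have : b * (dot v v + dot w w) = 0 by rewrite -[RHS]oppr0 -e; ring.
    move/eqP; rewrite mulf_eq0 => /orP[//|].
    by rewrite gt_eqF // ltr_wpDr ?dot_ge0 ?dot_gt0.
  by exists a, v; rewrite fv b0 scale0r subr0.
have [c /eigenvalueP[z zc z0]] := eigenvalue_closed (lfun_mx f) n_gt0.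
pose v := r2v z.
have v0 : v != 0.
  by apply: contraNneq z0 => v0; rewrite -[z]r2vK -/v v0 linear0.
have fv : f v = c *: v by rewrite lfun_mxE zc linearZ.
have := fH v v; rewrite fv linearZl_LR linearZr_LR /= => /mulIf cE.
have /complex_realP[a ca] : c \is Num.real.
  by rewrite CrealE -cE // dot_eq0.
by exists a, v; rewrite -ca.
Qed.

(** * The inner product inherited by a subspace *)

Section SubspaceDot.
Variables (K : numFieldType) (theta : {rmorphism K -> K}) (V : vectType K).
Variables (dot : {dot V for theta}) (Z : {vspace V}).

Definition subform := fun x y : subvs_of Z => dot (vsval x) (vsval y).

Fact subform_bilinear :
  bilinear_for (GRing.Scale.Law.clone _ _ *%R _)
    (GRing.Scale.Law.clone _ _ (theta \; *%R) _) subform.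
Proof.
split=> [y|x] a u v; rewrite /subform [vsval (_ + _)]linearP.
  by rewrite linearDl linearZl_LR.
by rewrite linearDr linearZr_LR.
Qed.

HB.instance Definition _ :=
  bilinear_isBilinear.Build K (subvs_of Z) (subvs_of Z) K _ _ subform
    subform_bilinear.

Fact subform_hermitian x y :
  subform x y = (-1) ^+ false * theta (subform y x).
Proof. exact: hermC. Qed.

HB.instance Definition _ :=
  isHermitianSesquilinear.Build K (subvs_of Z) false theta subform
    subform_hermitian.

Fact subform_posdef u : u != 0 -> 0 < subform u u.
Proof.
by move=> u0; apply: neq0_dnorm_gt0; apply: contraNneq u0 => u0; apply/eqP/val_inj.
Qed.

HB.instance Definition _ :=
  isDotProduct.Build K (subvs_of Z) subform subform_posdef.

Definition subdot : {dot (subvs_of Z) for theta} := subform.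

Lemma subdotE x y : subdot x y = dot (vsval x) (vsval y).
Proof. by []. Qed.

Lemma vsval_restr (T : 'End(V)) x :
  T (vsval x) \in Z -> vsval (restr T Z x) = T (vsval x).
Proof. by move=> TxZ; rewrite lfunE /= vsprojK. Qed.

Lemma restr_hermitian (T : 'End(V)) :
  {in Z, forall x, T x \in Z} ->
  {in Z &, forall x y, dot (T x) y = dot x (T y)} ->
  hermitian_op subdot (restr T Z).
Proof.
move=> TZ Th x y; rewrite !subdotE !vsval_restr ?TZ ?subvsP //.
by apply: Th; exact: subvsP.
Qed.

Lemma dim_subvs : \dim {: subvs_of Z} = \dim Z.
Proof. by rewrite dimvf. Qed.

End SubspaceDot.

(** * Orthonormal families, their coordinates and spans *)

Section OrthonormalFamily.
Variables (K : numFieldType) (theta : {rmorphism K -> K}) (V : vectType K).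
Variables (dot : {dot V for theta}) (n : nat).
Implicit Types (e : 'I_n -> V).

Definition orthonormal_family e := forall i j, dot (e i) (e j) = (i == j)%:R.

Lemma dot_sumZl (w : 'I_n -> V) (x : 'I_n -> K) y :
  dot (\sum_i x i *: w i) y = \sum_i x i * dot (w i) y.
Proof. by rewrite linear_sumlz; apply: eq_bigr => i _; exact: dotZl. Qed.

(** Squared norms [g i] other than 1 are allowed because the projected principal vectors, rescaled,
    are orthogonal but not of unit length. *)
Lemma dot_sum_orthogonal (w : 'I_n -> V) (g x y : 'I_n -> K) :
  (forall i j, dot (w i) (w j) = (i == j)%:R * g i) ->
  dot (\sum_i x i *: w i) (\sum_i y i *: w i) =
  \sum_i g i * (x i * theta (y i)).
Proof.
move=> ow; rewrite linear_sumr; apply: eq_bigr => j _ /=.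
rewrite dotZr dot_sumZl (bigD1 j) //= big1 => [|i ij].
  by rewrite addr0 ow eqxx mul1r [LHS]mulrC mulrAC [LHS]mulrC.
by rewrite ow (negPf ij) mul0r mulr0.
Qed.

Lemma dot_suml e (c : 'I_n -> K) j : orthonormal_family e ->
  dot (\sum_i c i *: e i) (e j) = c j.
Proof.
move=> oe; rewrite dot_sumZl (bigD1 j) //= big1 ?addr0 => [|i ij].
  by rewrite oe eqxx mulr1.
by rewrite oe (negPf ij) mulr0.
Qed.

Lemma dot_sum e (c d : 'I_n -> K) : orthonormal_family e ->
  dot (\sum_i c i *: e i) (\sum_i d i *: e i) = \sum_i c i * theta (d i).
Proof.
move=> oe; rewrite (dot_sum_orthogonal (g := fun=> 1)) => [|i j].
  by apply: eq_bigr => i _; rewrite mul1r.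
by rewrite oe mulr1.
Qed.

Lemma orthonormal_mktuple_free e : orthonormal_family e ->
  free [tuple e i | i < n].
Proof.
move=> oe; apply/freeP => k k0 i.
rewrite -(dot_suml k i oe) -[RHS](linear0l dot (e i)).
congr (dot _ _); rewrite -[RHS]k0; apply: eq_bigr => j _.
by rewrite -tnth_nth tnth_mktuple.
Qed.

Lemma orthonormal_expand e (Z : {vspace V}) x : orthonormal_family e ->
  (forall i, e i \in Z) -> \dim Z = n -> x \in Z ->
  x = \sum_i dot x (e i) *: e i.
Proof.
move=> oe eZ dZ xZ; have fe := orthonormal_mktuple_free oe.
have bZ : basis_of Z [tuple e i | i < n].
  rewrite basisEfree fe size_tuple dZ leqnn andbT; apply/span_subvP.
  by move=> _ /tnthP[i ->]; rewrite tnth_mktuple.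
have xE := coord_basis bZ xZ.
rewrite {1}xE; apply: eq_bigr => i _; rewrite -tnth_nth tnth_mktuple.
congr (_ *: _); rewrite [in RHS]xE.
rewrite -[LHS](dot_suml (fun j => coord [tuple e i | i < n] j x) i oe).
by congr (dot _ _); apply: eq_bigr => j _; rewrite -tnth_nth tnth_mktuple.
Qed.

Lemma orthonormal_expand_full e x : orthonormal_family e ->
  \dim {:V} = n -> x = \sum_i dot x (e i) *: e i.
Proof. by move=> oe dV; apply: (orthonormal_expand oe _ dV) => [i|]; exact: memvf. Qed.

Lemma orthonormal_dot e (Z : {vspace V}) x y : orthonormal_family e ->
  (forall i, e i \in Z) -> \dim Z = n -> x \in Z -> y \in Z ->
  dot x y = \sum_i dot x (e i) * theta (dot y (e i)).
Proof.
move=> oe eZ dZ xZ yZ.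
rewrite {1}(orthonormal_expand oe eZ dZ xZ) {1}(orthonormal_expand oe eZ dZ yZ).
exact: dot_sum.
Qed.

Lemma free_subfamily e (P : pred 'I_n) : orthonormal_family e ->
  free [seq e i | i <- enum 'I_n & P i].
Proof.
move=> oe; apply: (@catl_free _ _ [seq e i | i <- enum 'I_n & ~~ P i]).
rewrite -map_cat (perm_free (Y := codom e)); last first.
  by apply: perm_map; rewrite perm_filterC.
by have := orthonormal_mktuple_free oe; rewrite /= -codomE.
Qed.

Lemma span_subfamily_orth e (P : pred 'I_n) x k : orthonormal_family e ->
  x \in <<[seq e i | i <- enum 'I_n & P i]>>%VS -> ~~ P k -> dot x (e k) = 0.
Proof.
move=> oe xP Pk.
have /subvP/(_ x xP) :
    (<<[seq e i | i <- enum 'I_n & P i]>> <= orthov dot <[e k]>)%VS.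
  apply/span_subvP => _ /mapP[j + ->]; rewrite mem_filter => /andP[Pj _].
  rewrite mem_orthov1 /= oe; have [jk|//] := eqVneq j k.
  by rewrite -jk Pj in Pk.
by rewrite mem_orthov1 => /eqP.
Qed.

Lemma dim_span_subfamily e (P : pred 'I_n) : orthonormal_family e ->
  \dim <<[seq e i | i <- enum 'I_n & P i]>> = #|P|.
Proof.
move=> /(free_subfamily P)/eqP ->.
by rewrite size_map -sum1_size big_filter big_enum_cond /= sum1_card.
Qed.

End OrthonormalFamily.

(** * Spectral theorem, eigenvalue lists and variational comparison *)

Section Spectral.
Variables (R : realType) (s : scalar_kind).
Local Notation K := (scalars R s).
Local Notation theta := (conjugation R s).
Local Notation iota := (of_real R s).

Lemma normalize (V : vectType K) (dot : {dot V for theta}) (v : V) :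
  v != 0 -> exists2 c : K, c != 0 & dot (c *: v) (c *: v) = 1.
Proof.
move=> v0; have [r rE] := ge0_of_real (dot_ge0 dot v).
have r0 : 0 < r.
  rewrite lt_neqAle eq_sym -(of_real_le s) rmorph0 -rE dot_ge0 andbT.
  by apply: contra_neq v0 => r0; apply/eqP; rewrite -(dot_eq0 dot) rE r0 rmorph0.
exists (iota (Num.sqrt r)^-1); first by rewrite fmorph_eq0 invr_eq0 sqrtr_eq0 -ltNge.
rewrite dotZl dotZr conj_of_real rE -!rmorphM /= mulrA -invfM -expr2 sqr_sqrtr ?ltW //.
by rewrite mulVf ?rmorph1 // gt_eqF.
Qed.

(** Induction on the dimension: a unit eigenvector [v] is split off, and [f], being Hermitian,
    preserves the hyperplane orthogonal to [v]. *)
Lemma hermitian_diagonalizable n (V : vectType K) (dot : {dot V for theta})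
    (f : 'End(V)) :
  \dim {:V} = n -> hermitian_op dot f ->
  exists (e : 'I_n -> V) (a : 'I_n -> R),
    orthonormal_family dot e /\ forall i, f (e i) = iota (a i) *: e i.
Proof.
elim: n V dot f => [|n IHn] V dot f dV fh.
  by exists (fun=> 0), (fun=> 0); split=> [] [].
have [|a [v' [v'0 fv']]] := hermitian_eigenvector fh; first by rewrite dV.
have [c c0 v1] := normalize dot v'0.
set v := c *: v' in v1.
have fv : f v = iota a *: v by rewrite linearZ /= fv' scalerA mulrC -scalerA.
pose Z := orthov dot <[v]>%VS.
have dZ : \dim {: subvs_of Z} = n.
  have := @eq_dim_orthov1 _ _ _ _ dot v {:V}; rewrite dV /= capfv dim_subvs => <- //.
  by apply/mem_orthovPn; exists v; rewrite ?memvf //= v1 oner_eq0.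
have memZ x : x \in Z -> dot x v = 0 by rewrite mem_orthov1 => /eqP.
have fZ : {in Z, forall x, f x \in Z}.
  by move=> x /memZ xv; rewrite mem_orthov1 /= fh fv dotZr xv mulr0.
have [|e' [a' [oe' fe']]] := IHn _ (subdot dot Z) (restr f Z) dZ.
  by apply: restr_hermitian => // x y _ _; exact: fh.
(* Index [ord0] carries [v], and the other indices carry the family found inside [Z]. *)
exists (fun i => oapp (vsval \o e') v (unlift ord0 i)).
exists (fun i => oapp a' a (unlift ord0 i)); split=> [i j|i].
- case: (unliftP ord0 i) => [i'|] ->; case: (unliftP ord0 j) => [j'|] -> /=.
  + by rewrite -subdotE oe' (inj_eq lift_inj).
  + by rewrite memZ ?subvsP.
  + by rewrite dot_sym0 // memZ ?subvsP.
  + by rewrite v1.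
- case: (unliftP ord0 i) => [i' _|_] //=.
  by rewrite -(vsval_restr (fZ _ (subvsP _))) fe' linearZ.
Qed.

(** The eigenvalues decrease so that they match [Lambda] entry by entry; when [n] is the dimension
    this is an orthonormal eigenbasis. *)
Definition eigenframe (V : vectType K) (dot : {dot V for theta}) (f : 'End(V)) n
    (e : 'I_n -> V) (a : 'I_n -> R) :=
  [/\ orthonormal_family dot e, forall i, f (e i) = iota (a i) *: e i &
      forall i j : 'I_n, (i <= j)%N -> a j <= a i].

Lemma hermitian_eigenframe n (V : vectType K) (dot : {dot V for theta})
    (f : 'End(V)) :
  \dim {:V} = n -> hermitian_op dot f ->
  exists (e : 'I_n -> V) (a : 'I_n -> R), eigenframe dot f e a.
Proof.
move=> dV fh; have [e [a [oe fe]]] := hermitian_diagonalizable dV fh.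
have [p pI ps] := sort_perm a.
exists (e \o p), (a \o p); split=> //= i j.
by rewrite oe (inj_eq pI).
Qed.

Lemma eigenframe_coord (V : vectType K) (dot : {dot V for theta}) (f : 'End(V))
    n (e : 'I_n -> V) (a : 'I_n -> R) x i :
  hermitian_op dot f -> eigenframe dot f e a ->
  dot (f x) (e i) = iota (a i) * dot x (e i).
Proof. by move=> fh [_ fe _]; rewrite fh fe dotZr conj_of_real. Qed.

Lemma leigenspaceP (V : vectType K) (f : 'End(V)) (c : K) x :
  reflect (f x = c *: x) (x \in passmx.leigenspace f c).
Proof.
by rewrite memv_ker !lfun_simp subr_eq0; apply: eqP.
Qed.

(** An eigenvector for [b] has a zero coordinate along [e i] unless [a i = b]. The eigenspace is
    therefore the span of the remaining [e i], and its dimension counts the occurrences of [b]. *)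
Lemma eigenframe_spectrum (V : vectType K) (dot : {dot V for theta})
    (f : 'End(V)) n (e : 'I_n -> V) (a : 'I_n -> R) :
  \dim {:V} = n -> hermitian_op dot f -> eigenframe dot f e a ->
  is_spectrum iota f (codom a).
Proof.
move=> dV fh efe; have [oe fe aS] := efe; split.
- exact: sorted_codom.
- by rewrite size_codom card_ord.
move=> b; pose eb := [seq e i | i <- enum 'I_n & a i == b].
have -> : passmx.leigenspace f (iota b) = <<eb>>%VS.
  apply/eqP; rewrite eqEsubv; apply/andP; split; last first.
    apply/span_subvP => _ /mapP[j + ->]; rewrite mem_filter => /andP[/eqP<- _].
    exact/leigenspaceP.
  apply/subvP => x /leigenspaceP fx; rewrite (orthonormal_expand_full x oe dV).
  apply: memv_suml => i _; have [ab|ab] := eqVneq (a i) b.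
    by apply/memvZ/memv_span/map_f; rewrite mem_filter ab eqxx mem_enum.
  have := eigenframe_coord x i fh efe; rewrite fx dotZl => /eqP.
  rewrite -subr_eq0 -mulrBl mulf_eq0 subr_eq0 (inj_eq (fmorph_inj iota)).
  by rewrite eq_sym (negPf ab) => /eqP ->; rewrite scale0r mem0v.
rewrite (dim_span_subfamily _ oe) /codom /image_mem count_map.
by rewrite -size_filter cardE {2}/enum_mem -enumT; congr size; apply: eq_filter.
Qed.

Lemma is_spectrum_unique (V : vectType K) (f : 'End(V)) (s1 s2 : seq R) :
  is_spectrum iota f s1 -> is_spectrum iota f s2 -> s1 = s2.
Proof.
move=> [s1S _ c1] [s2S _ c2]; apply: (sorted_eq ge_trans ge_anti) => //.
by apply/allP => b _; rewrite /= c1 c2.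
Qed.

Lemma Lambda_eigenframe (V : vectType K) (dot : {dot V for theta})
    (f : 'End(V)) n (e : 'I_n -> V) (a : 'I_n -> R) :
  \dim {:V} = n -> hermitian_op dot f -> eigenframe dot f e a ->
  Lambda iota f = codom a.
Proof.
move=> dV fh efe; apply: xget_unique; first exact: eigenframe_spectrum efe.
by move=> t /is_spectrum_unique; apply; exact: eigenframe_spectrum efe.
Qed.

Lemma Lambda_nth (V : vectType K) (dot : {dot V for theta})
    (f : 'End(V)) n :
  \dim {:V} = n -> hermitian_op dot f ->
  exists e : 'I_n -> V, eigenframe dot f e (fun i => (Lambda iota f)`_i).
Proof.
move=> dV fh; have [e [a efe]] := hermitian_eigenframe dV fh.
exists e; rewrite (Lambda_eigenframe dV fh efe).
have [oe fe aS] := efe; split=> // *; rewrite !codom_nth //; exact: aS.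
Qed.

Lemma size_Lambda (V : vectType K) (dot : {dot V for theta})
    (f : 'End(V)) : hermitian_op dot f -> size (Lambda iota f) = \dim {:V}.
Proof.
move=> fh; have [e [a efe]] := hermitian_eigenframe erefl fh.
by rewrite (Lambda_eigenframe erefl fh efe) size_codom card_ord.
Qed.

Section Frame.
Variables (V : vectType K) (dot : {dot V for theta}) (f : 'End(V)).
Variables (n : nat) (e : 'I_n -> V) (a : 'I_n -> R).
Hypotheses (dV : \dim {:V} = n) (fh : hermitian_op dot f).
Hypothesis efe : eigenframe dot f e a.

Lemma eigenframe_form x :
  dot x (f x) = \sum_i iota (a i) * (dot x (e i) * theta (dot x (e i))).
Proof.
have [oe _ _] := efe.
rewrite -fh (orthonormal_dot oe _ dV) ?memvf //; last by move=> i; exact: memvf.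
by apply: eq_bigr => i _; rewrite (eigenframe_coord _ _ fh efe) mulrA.
Qed.

Lemma frame_norm x : dot x x = \sum_i dot x (e i) * theta (dot x (e i)).
Proof.
have [oe _ _] := efe.
by rewrite (orthonormal_dot oe _ dV) ?memvf // => i; exact: memvf.
Qed.

Lemma rayleigh_le x b : (forall k, dot x (e k) = 0 \/ a k <= b) ->
  dot x (f x) <= iota b * dot x x.
Proof.
move=> xb; rewrite eigenframe_form frame_norm mulr_sumr; apply: ler_sum => k _.
have [->|akb] := xb k; first by rewrite !(mul0r, mulr0).
by rewrite ler_wpM2r ?mul_conj_ge0 ?of_real_le.
Qed.

Lemma rayleigh_ge x b : (forall k, dot x (e k) = 0 \/ b <= a k) ->
  iota b * dot x x <= dot x (f x).
Proof.
move=> xb; rewrite eigenframe_form frame_norm mulr_sumr; apply: ler_sum => k _.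
have [->|akb] := xb k; first by rewrite !(mul0r, mulr0).
by rewrite ler_wpM2r ?mul_conj_ge0 ?of_real_le.
Qed.

End Frame.

(* Courant-Fischer: the span of the [e1 k] with [i <= k] is mapped by [T] onto a
   space that meets the span of the [e2 k] with [k <= j]. *)
Lemma eigenvalue_comparison (V1 V2 : vectType K)
    (dot1 : {dot V1 for theta}) (dot2 : {dot V2 for theta})
    (f1 : 'End(V1)) (f2 : 'End(V2)) n m e1 e2 (a1 : 'I_n -> R) (a2 : 'I_m -> R)
    (T : 'Hom(V1, V2)) (c : R) (i : 'I_n) (j : 'I_m) :
  \dim {:V1} = n -> \dim {:V2} = m ->
  hermitian_op dot1 f1 -> hermitian_op dot2 f2 ->
  eigenframe dot1 f1 e1 a1 -> eigenframe dot2 f2 e2 a2 ->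
  lker T = 0%VS -> 0 <= c ->
  (forall x, iota c * dot2 (T x) (f2 (T x)) * dot1 x x
             <= dot1 x (f1 x) * dot2 (T x) (T x)) ->
  (j + n = i + m)%N -> c * a2 j <= a1 i.
Proof.
move=> d1 d2 h1 h2 E1 E2 T0 c0 cmp ij.
have [oe1 _ s1] := E1; have [oe2 _ s2] := E2.
pose U1 := <<[seq e1 k | k : 'I_n <- enum 'I_n & ~~ (k < i)%N]>>%VS.
pose U2 := <<[seq e2 k | k : 'I_m <- enum 'I_m & (k < j.+1)%N]>>%VS.
have dU1 : \dim (T @: U1)%VS = (n - i)%N.
  rewrite limg_dim_eq ?T0 ?capv0 // (dim_span_subfamily _ oe1).
  rewrite -[X in (X - _)%N]card_ord -(cardC [pred k : 'I_n | (k < i)%N]).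
  by rewrite card_ord_lt ?(ltnW (ltn_ord i)) // addKn.
have dU2 : \dim U2 = j.+1.
  by rewrite (dim_span_subfamily _ oe2) card_ord_lt.
(* By [ij] the dimensions [n - i] and [j.+1] add up to [m + 1], so the two subspaces of [V2] share a
   nonzero vector. *)
have [y yU y0] : exists2 y, y \in (T @: U1 :&: U2)%VS & y != 0.
  exists (vpick (T @: U1 :&: U2)%VS); first exact: memv_pick.
  rewrite vpick0 -dimv_eq0 -lt0n -(ltn_add2l (\dim (T @: U1 + U2)%VS)).
  rewrite dimv_sum_cap dU1 dU2 addn0.
  apply: (@leq_ltn_trans m); first by rewrite -d2 dimvS ?subvf.
  by have := ltn_ord i; have := ltn_ord j; lia.
move: yU; rewrite memv_cap => /andP[/memv_imgP[x xU1 yE]]; rewrite {}yE in y0 *.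
move=> TxU2.
have x0 : x != 0 by apply: contraNneq y0 => ->; rewrite linear0.
have f1x : dot1 x (f1 x) <= iota (a1 i) * dot1 x x.
  apply: (rayleigh_le d1 h1 E1) => k.
  have [ki|ki] := ltnP k i; last by right; apply: s1.
  by left; apply: (span_subfamily_orth oe1 xU1); rewrite negbK.
have f2x : iota (a2 j) * dot2 (T x) (T x) <= dot2 (T x) (f2 (T x)).
  apply: (rayleigh_ge d2 h2 E2) => k.
  have [kj|kj] := leqP k j; first by right; apply: s2.
  by left; apply: (span_subfamily_orth oe2 TxU2); rewrite ltnS -ltnNge.
have n1 := dot_gt0 dot1 x0; have n2 := dot_gt0 dot2 y0.
rewrite -(of_real_le s) rmorphM -(ler_pM2r n2) -(ler_pM2r n1).
(* The Rayleigh quotient of [f1] at [x] is at most [a1 i], that of [f2] at [T x] is at least [a2 j],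
   and [cmp] links the two. *)
apply: (@le_trans _ _ (iota c * dot2 (T x) (f2 (T x)) * dot1 x x)).
  rewrite ler_wpM2r ?dot_ge0 // -mulrA ler_wpM2l //.
  by rewrite -(rmorph0 iota) of_real_le.
by apply: (le_trans (cmp x)); rewrite mulrAC ler_wpM2r ?dot_ge0.
Qed.

End Spectral.

(** * Orthogonal projectors *)

Section OrthogonalProjection.
Variables (R : realType) (s : scalar_kind).
Local Notation K := (scalars R s).
Variables (V : vectType K) (dot : {dot V for conjugation R s}) (Z : {vspace V}).

(** The spectral theorem for the identity of [Z] does the work of Gram-Schmidt. *)
Lemma orthonormal_basis : exists2 e : 'I_(\dim Z) -> V,
  orthonormal_family dot e & forall i, e i \in Z.
Proof.
have [||e [a [oe _]]] := @hermitian_diagonalizable R s (\dim Z) _ (subdot dot Z) \1%VF.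
- exact: dim_subvs.
- by move=> x y; rewrite !id_lfunE.
by exists (vsval \o e) => [i j|i]; [exact: oe|exact: subvsP].
Qed.

Lemma orthov_cap : (Z :&: orthov dot Z = 0)%VS.
Proof.
apply/eqP; rewrite -subv0; apply/subvP => x; rewrite memv_cap => /andP[xZ].
by move=> /mem_orthovP/(_ x xZ) /eqP; rewrite dot_eq0 memv0.
Qed.

Lemma addv_orthov : (Z + orthov dot Z = {:V})%VS.
Proof.
apply/vspaceP => x; rewrite memvf.
have [e oe eZ] := orthonormal_basis.
rewrite -[x](subrKC (\sum_i dot x (e i) *: e i)) memv_add //.
  by apply: memv_suml => i _; exact: memvZ.
apply/mem_orthovP => y yZ; rewrite (orthonormal_expand oe eZ erefl yZ).
rewrite linear_sumr big1 // => i _ /=; rewrite dotZr linearBl /=.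
by rewrite (dot_suml _ i oe) subrr mulr0.
Qed.

Lemma oproj_mem x : oproj dot Z x \in Z.
Proof. exact: memv_pi. Qed.

Lemma oproj_id x : x \in Z -> oproj dot Z x = x.
Proof. exact/daddv_pi_id/orthov_cap. Qed.

Lemma dot_oprojl x y : y \in Z -> dot (oproj dot Z x) y = dot x y.
Proof.
move=> yZ; have xV : x \in (Z + orthov dot Z)%VS by rewrite addv_orthov memvf.
rewrite -{2}(daddv_pi_add orthov_cap xV) linearDl /=.
by have /mem_orthovP/(_ y yZ) /= -> := memv_pi (orthov dot Z) Z x; rewrite addr0.
Qed.

Lemma dot_oprojr x y : y \in Z -> dot y (oproj dot Z x) = dot y x.
Proof. by move=> yZ; rewrite dotC dot_oprojl // -dotC. Qed.

Lemma oproj_norm_le x : dot (oproj dot Z x) (oproj dot Z x) <= dot x x.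
Proof.
set y := oproj dot Z x; have yZ : y \in Z := oproj_mem x.
rewrite -[x in leRHS](subrK y) hnormDd /=; first by rewrite lerDr dot_ge0.
by rewrite linearBl /= dot_oprojl // subrr.
Qed.

End OrthogonalProjection.

Lemma orthonormal_hom (K : numFieldType) (theta : {rmorphism K -> K})
    (V W : vectType K) (dot : {dot V for theta}) n (u : 'I_n -> V)
    (w : 'I_n -> W) : orthonormal_family dot u ->
  exists f : 'Hom(V, W), forall i, f (u i) = w i.
Proof.
move=> ou; have [f fE] := linear_of_free (codom u) (codom w).
exists (linfun f) => i; rewrite lfunE /=.
have := orthonormal_mktuple_free ou; rewrite /= -codomE => /fE.
rewrite !size_codom => /(_ erefl) /(congr1 (fun t => nth 0 t i)).
by rewrite (nth_map 0) ?size_codom ?card_ord // !codom_nth.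
Qed.

(** * Multiplicative perturbation of a Hermitian operator *)

Section Perturbation.
Variables (R : realType) (s : scalar_kind).
Local Notation K := (scalars R s).
Local Notation theta := (conjugation R s).
Local Notation iota := (of_real R s).

Lemma orthonormal_eigen_form (V : vectType K) (dot : {dot V for theta}) n
    (u : 'I_n -> V) (sg : 'I_n -> R) (S : 'End(V)) x y :
  \dim {:V} = n -> orthonormal_family dot u ->
  (forall i, S (u i) = iota (sg i) *: u i) ->
  dot (S x) y = \sum_i iota (sg i) * (dot x (u i) * theta (dot y (u i))).
Proof.
move=> dV ou Su; rewrite {1}(orthonormal_expand_full x ou dV).
rewrite {1}(orthonormal_expand_full y ou dV) [S _]linear_sum.
under eq_bigr => i _ do rewrite linearZ /= Su scalerA.
by rewrite dot_sum //; apply: eq_bigr => i _; ring.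
Qed.

(** Take [B] to be [f] after [S], where [S] scales each [u i] by [sg i]. As [S] is self-adjoint for
    [dotA], [B] is Hermitian for [dot]. Its form is that of [f] with the coordinates along [u i]
    weighted by [sg i], hence the lower bound on [b]; determinants give the product. *)
Lemma eigenframe_perturbation (V : vectType K) (dot dotA : {dot V for theta}) n
    (f : 'End(V)) (e u : 'I_n -> V) (a sg : 'I_n -> R) :
  \dim {:V} = n -> hermitian_op dot f -> eigenframe dot f e a ->
  (forall x y, dotA x y = dot x (f y)) -> orthonormal_family dotA u ->
  exists (B : 'End(V)) (eb : 'I_n -> V) (b : 'I_n -> R),
    [/\ hermitian_op dot B, eigenframe dot B eb b,
        forall x, dot x (B x) =
          \sum_i iota (sg i) * (dotA x (u i) * theta (dotA x (u i))),
        \prod_i b i = \prod_i a i * \prod_i sg i &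
        forall c, 0 <= c -> (forall i, c <= sg i) -> forall i, c * a i <= b i].
Proof.
move=> dV fh E dotAE ou; have [oe fe as_] := E.
have [S Su] := orthonormal_hom (fun i => iota (sg i) *: u i) ou.
have Sform x y := orthonormal_eigen_form x y dV ou Su.
have Bh : hermitian_op dot (f \o S)%VF.
  move=> x y; rewrite !comp_lfunE fh -!dotAE Sform dotC Sform rmorph_sum.
  apply: eq_bigr => i _ /=; rewrite !rmorphM /= conj_of_real -!dotC.
  ring.
have [eb [b EB]] := hermitian_eigenframe dV Bh.
have Bform x : dot x ((f \o S)%VF x) =
    \sum_i iota (sg i) * (dotA x (u i) * theta (dotA x (u i))).
  by rewrite -Bh comp_lfunE fh -dotAE Sform.
exists (f \o S)%VF, eb, b; split=> //.
  have [ob Be _] := EB.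
  apply: (fmorph_inj iota); rewrite rmorphM !rmorph_prod.
  rewrite -(det_lfun_mx dV (orthonormal_mktuple_free ob) Be).
  rewrite -(det_lfun_mx dV (orthonormal_mktuple_free oe) fe).
  rewrite -(det_lfun_mx dV (orthonormal_mktuple_free ou) Su).
  by rewrite lfun_mx_comp det_mulmx mulrC.
move=> c c0 csg i.
apply: (@eigenvalue_comparison R s V V dot dot (f \o S)%VF f n n eb e b a \1%VF c i i)
  => //.
  by apply/eqP; apply/lker0P => x y; rewrite !id_lfunE.
move=> x; rewrite id_lfunE Bform ler_wpM2r ?dot_ge0 // -dotAE.
have uV i' : u i' \in {:V}%VS by exact: memvf.
rewrite (orthonormal_dot ou uV dV) ?memvf // mulr_sumr.
by apply: ler_sum => k _; rewrite ler_wpM2r ?mul_conj_ge0 ?of_real_le.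
Qed.

Lemma eigenframe_pos (V : vectType K) (dot : {dot V for theta}) n
    (f : 'End(V)) (e : 'I_n -> V) (a : 'I_n -> R) i :
  posdef_op dot f -> eigenframe dot f e a -> 0 < a i.
Proof.
move=> fp [oe fe _].
have e0 : e i != 0 by rewrite -(dot_eq0 dot) oe eqxx oner_eq0.
have := fp _ e0; rewrite fe dotZr oe eqxx mulr1 conj_of_real -(rmorph0 iota).
by rewrite !lt_neqAle of_real_le (inj_eq (fmorph_inj iota)).
Qed.

End Perturbation.

(** * Decreasing rearrangements and weak majorization *)

Section Majorization.
Variables (R : realType) (n : nat).
Implicit Types x y : 'I_n -> R.

Lemma size_decreasing x : size (decreasing x) = n.
Proof. by rewrite size_sort size_codom card_ord. Qed.

Lemma decreasing_sorted x i j : (i <= j < n)%N ->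
  (decreasing x)`_j <= (decreasing x)`_i.
Proof.
move=> /andP[ij jn].
have := @sorted_leq_nth _ >=%R ge_trans (fun=> lexx _) 0 _
  (sort_sorted ge_total (codom x)) i j.
rewrite !inE -/(decreasing x) size_decreasing => /(_ (leq_ltn_trans ij jn) jn ij).
exact.
Qed.

Lemma decreasing_perm x : exists2 p : 'I_n -> 'I_n, injective p &
  decreasing x = codom (x \o p).
Proof.
have [p pI ps] := sort_perm x; exists p => //.
apply: (sorted_eq ge_trans ge_anti); first exact: sort_sorted ge_total _.
  exact: sorted_codom.
rewrite perm_sort /codom /image_mem (map_comp x p); apply: perm_map.
apply: uniq_perm => [||i]; first exact: enum_uniq.
  by rewrite map_inj_uniq ?enum_uniq.
by rewrite mem_enum -(f_invF pI i) map_f ?mem_enum.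
Qed.

Lemma decreasing_id x : (forall i j : 'I_n, (i <= j)%N -> x j <= x i) ->
  decreasing x = codom x.
Proof. by move=> /sorted_codom; apply: sorted_sort; apply: ge_trans. Qed.

Lemma decreasing_map (phi : R -> R) x : {homo phi : u v / u <= v} ->
  decreasing (phi \o x) = [seq phi u | u <- decreasing x].
Proof.
move=> phiM; rewrite /decreasing /codom /image_mem (map_comp phi x).
apply: (sorted_eq ge_trans ge_anti); first exact: sort_sorted ge_total _.
  apply: (homo_sorted (e := >=%R)); first by move=> u v; apply: phiM.
  exact: sort_sorted ge_total _.
by rewrite perm_sort perm_map // perm_sym perm_sort.
Qed.

Lemma le_decreasing0 x i : x i <= (decreasing x)`_0.
Proof.
have xi : x i \in decreasing x by rewrite mem_sort; apply: codom_f.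
have := xi; rewrite -index_mem size_decreasing => lt_n.
by rewrite -{1}(nth_index 0 xi); apply: decreasing_sorted.
Qed.

Lemma weak_majorized_exp x y : weak_majorized x y ->
  weak_majorized (fun i => expR (x i) - 1) (fun i => expR (y i) - 1).
Proof.
have phiM : {homo (fun u : R => expR u - 1) : u v / u <= v}.
  by move=> u v uv; rewrite lerB ?ler_expR.
move=> xy k /andP[k0 kn].
rewrite -[fun i => expR (x i) - 1]/((fun u => expR u - 1) \o x).
rewrite -[fun i => expR (y i) - 1]/((fun u => expR u - 1) \o y).
rewrite !decreasing_map // -subr_ge0 -sumrB.
(* [e^Y - e^X >= e^X (Y - X)], then summation by parts. *)
pose X i := (decreasing x)`_i; pose Y i := (decreasing y)`_i.
have XS i j : (i <= j < n)%N -> X j <= X i by exact: decreasing_sorted.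
have W j : (j <= k)%N -> 0 <= \sum_(i < j) (Y i - X i).
  case: j => [|j] jk; first by rewrite big_ord0.
  by rewrite sumrB subr_ge0; apply: xy; rewrite (leq_trans jk kn).
apply: (@le_trans _ _ (\sum_(i < k) expR (X i) * (Y i - X i))); last first.
  apply: ler_sum => i _; have ik := leq_trans (ltn_ord i) kn.
  rewrite !(nth_map 0) ?size_decreasing // -/(X i) -/(Y i).
  have := ler_wpM2l (expR_ge0 (X i)) (expR_ge1Dx (Y i - X i)).
  by rewrite -expRD subrKC mulrDr mulr1; lra.
(* The weights [expR (X j)] decrease and the partial sums of [Y - X] are nonnegative, so passing to
   the next weight can only lower the left-hand side. *)
have abel j : (j < k)%N ->
    expR (X j) * \sum_(i < j.+1) (Y i - X i) <=
    \sum_(i < j.+1) expR (X i) * (Y i - X i).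
  elim: j => [|j IHj] jk; first by rewrite !big_ord1.
  rewrite (big_ord_recr j.+1) [leRHS]big_ord_recr /= mulrDr lerD2r.
  apply: le_trans (IHj (ltnW jk)); apply: ler_wpM2r; first exact/W/ltnW.
  by rewrite ler_expR XS // leqnSn (leq_trans jk).
case: k k0 {kn} W abel => // k _ W abel.
by apply: le_trans (abel k _) => //; rewrite mulr_ge0 ?expR_ge0 ?W.
Qed.

Lemma ln_prod (F : 'I_n -> R) : (forall i, 0 < F i) ->
  ln (\prod_i F i) = \sum_i ln (F i).
Proof.
move=> F0; suff [] : 0 < \prod_i F i /\ ln (\prod_i F i) = \sum_i ln (F i) by [].
elim/big_rec2: _ => [|i u v _ [v0 lnv]]; first by rewrite ln1.
by rewrite mulr_gt0 // lnM ?posrE // lnv.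
Qed.

(* Li-Mathias truncation: every [b i / (g j * lam i)] is at least 1, so the
   product of any of these is bounded by the product of all of them. *)
Lemma weak_majorized_ln (lam mu g : 'I_n -> R) :
  (forall i, 0 < lam i) -> (forall i, 0 < mu i) -> (forall i, 0 < g i) ->
  (forall i j : 'I_n, (i <= j)%N -> g j <= g i) ->
  (forall j, exists b : 'I_n -> R, [/\ forall i, mu i <= b i,
    forall i, g j * lam i <= b i &
    \prod_i b i = \prod_i lam i * \prod_i Num.max (g i) (g j)]) ->
  weak_majorized (fun i => ln (mu i / lam i)) (fun i => ln (g i)).
Proof.
move=> lam0 mu0 g0 gS H k /andP[k0 kn].
have [p pI ->] := decreasing_perm (fun i => ln (mu i / lam i)).
have lngS (i j : 'I_n) : (i <= j)%N -> ln (g j) <= ln (g i).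
  by move=> ij; rewrite ler_ln ?posrE // gS.
rewrite (decreasing_id lngS).
have narrow (F : 'I_n -> R) :
    \sum_(i < k) (codom F)`_i = \sum_(i : 'I_n | (i < k)%N) F i.
  rewrite (big_ord_narrow kn); apply: eq_bigr => i _.
  by rewrite -(codom_nth F 0).
rewrite !narrow.
(* Indices start at 0, so [g j] is the [k]-th largest of the [g i]; it is the truncation level. *)
have k1n : (k.-1 < n)%N by rewrite prednK.
pose j := Ordinal k1n; have [b [mub gb prodb]] := H j.
have b0 i : 0 < b i by apply: lt_le_trans (mub i).
pose d i := ln (b i) - ln (lam i) - ln (g j).
have d0 i : 0 <= d i.
  by rewrite /d -addrA -opprD subr_ge0 addrC -lnM ?posrE // ler_ln ?posrE ?mulr_gt0.
(* [Num.max (g i) (g j)] can differ from [g j] only for [i < k], so the logarithm of the product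
   identity leaves just these terms. *)
have sumd : \sum_i d i = \sum_(i : 'I_n | (i < k)%N) (ln (g i) - ln (g j)).
  have mx0 i : 0 < Num.max (g i) (g j) by rewrite lt_max g0.
  have lamP : 0 < \prod_i lam i by apply: prodr_gt0 => i _.
  have mxP : 0 < \prod_i Num.max (g i) (g j) by apply: prodr_gt0 => i _.
  have := congr1 (@ln R) prodb; rewrite lnM ?posrE //.
  rewrite !ln_prod // => lnb.
  rewrite [LHS]sumrB [X in X - _ = _]sumrB lnb.
  rewrite [\sum_i ln (lam i) + _]addrC addrK -sumrB [RHS]big_mkcond /=.
  apply: eq_bigr => i _; case: ltnP => ik.
    by rewrite max_l // gS //= -ltnS prednK.
  by rewrite max_r ?subrr // gS //= (leq_trans (leq_pred k)).
apply: (@le_trans _ _ (\sum_(i : 'I_n | (i < k)%N) (d (p i) + ln (g j)))).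
  apply: ler_sum => i _ /=; rewrite /d subrK ln_div ?posrE // lerD2r.
  by rewrite ler_ln ?posrE.
(* All [d i] are nonnegative, so the [k] of them selected by [p] sum to at most the total. *)
rewrite big_split /= -lerBrDr -sumrB -sumd.
rewrite [leRHS](reindex_inj pI) /= [leRHS](bigID (fun i : 'I_n => (i < k)%N)) /=.
by rewrite lerDl sumr_ge0.
Qed.

End Majorization.

(** * Compressions of an operator to a subspace *)

Section Compression.
Variables (R : realType) (s : scalar_kind).
Local Notation K := (scalars R s).
Local Notation theta := (conjugation R s).
Local Notation iota := (of_real R s).
Variables (H : vectType K) (dot : {dot H for theta}) (Z : {vspace H}).

Lemma vsval_compression (A : 'End(H)) x :
  vsval (restr (oproj dot Z \o A)%VF Z x) = oproj dot Z (A (vsval x)).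
Proof. by rewrite vsval_restr comp_lfunE //= oproj_mem. Qed.

Lemma compression_form (A : 'End(H)) x y :
  subdot dot Z x (restr (oproj dot Z \o A)%VF Z y) = dot (vsval x) (A (vsval y)).
Proof. by rewrite subdotE vsval_compression dot_oprojr ?subvsP. Qed.

Lemma compression_hermitian (A : 'End(H)) : hermitian_op dot A ->
  hermitian_op (subdot dot Z) (restr (oproj dot Z \o A)%VF Z).
Proof.
move=> hA x y; rewrite compression_form subdotE vsval_compression.
by rewrite dot_oprojl ?subvsP.
Qed.

Lemma oproj_hermitian : hermitian_op dot (oproj dot Z).
Proof.
by move=> x y; rewrite -(dot_oprojr dot y (oproj_mem dot Z x)) dot_oprojl ?oproj_mem.
Qed.

End Compression.

(** * Principal vectors and principal angles *)

Section Angles.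
Variables (R : realType) (s : scalar_kind).
Local Notation K := (scalars R s).
Local Notation theta := (conjugation R s).
Local Notation iota := (of_real R s).
Variables (H : vectType K) (dot : {dot H for theta}) (X Y : {vspace H}).
Local Notation P := (oproj dot X).
Local Notation Q := (oproj dot Y).
Local Notation k := (\dim X).

(** The [u i] diagonalize the compression to [X] of the projector onto [Y]; [c i] is the squared
    norm of the projection of the unit vector [u i], whence its bounds. *)
Lemma principal_vectors : exists (u : 'I_k -> subvs_of X) (c : 'I_k -> R),
  [/\ orthonormal_family (subdot dot X) u,
      forall i, P (Q (vsval (u i))) = iota (c i) *: vsval (u i),
      forall i : 'I_k, (Theta iota dot X Y)`_i = acos (Num.sqrt (c i)),
      forall i, 0 <= c i <= 1 &
      forall i j : 'I_k, (i <= j)%N -> c i <= c j].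
Proof.
have hPQ := compression_hermitian (Z := X) (oproj_hermitian dot Y).
have [u [ou PQu cS]] := Lambda_nth (dim_subvs X) hPQ.
have sL := size_Lambda hPQ; rewrite dim_subvs in sL.
pose L := Lambda iota (restr (P \o Q)%VF X).
have PQu' i : P (Q (vsval (u i))) = iota L`_i *: vsval (u i).
  by rewrite -vsval_compression PQu linearZ.
(* The order is reversed because [Lambda] decreases, whereas decreasing angles have increasing
   cosines. *)
exists (u \o rev_ord (n := k)), (fun i => L`_(rev_ord i)); split=> [i j|i|i|i|i j ij] /=.
- by rewrite ou (inj_eq rev_ord_inj).
- exact: PQu'.
- by rewrite /Theta (nth_map 0) ?size_rev ?sL // nth_rev ?sL.
- have cE : iota L`_(rev_ord i) = dot (Q (vsval (u (rev_ord i)))) (Q (vsval (u (rev_ord i)))).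
    rewrite dot_oprojl ?oproj_mem // -compression_form PQu dotZr ou eqxx mulr1.
    by rewrite conj_of_real.
  rewrite -!(of_real_le s) cE rmorph0 rmorph1 dot_ge0 /=.
  by apply: (le_trans (oproj_norm_le _ _ _)); rewrite -subdotE ou eqxx.
- by apply: (cS (rev_ord j) (rev_ord i)); rewrite /= leq_sub2l.
Qed.

End Angles.

Lemma sin_acos_sqrt (R : realType) (c : R) : 0 <= c <= 1 ->
  sin (acos (Num.sqrt c)) ^+ 2 = 1 - c.
Proof.
move=> /andP[c0 c1]; rewrite sin2cos2 acosK ?sqr_sqrtr //.
by rewrite in_itv /= (le_trans (lerN10 _)) ?sqrtr_ge0 //= -sqrtr1 ler_sqrt.
Qed.

Lemma tan_acos_sqrt (R : realType) (c : R) : 0 < c <= 1 ->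
  1 + tan (acos (Num.sqrt c)) ^+ 2 = c^-1.
Proof.
move=> /andP[c0 c1].
have cosE : cos (acos (Num.sqrt c)) = Num.sqrt c.
  rewrite acosK // in_itv /= (le_trans (lerN10 _)) ?sqrtr_ge0 //=.
  by rewrite -sqrtr1 ler_sqrt.
rewrite -cos2_tan2 cosE ?gt_eqF ?sqrtr_gt0 //.
by rewrite sqr_sqrtr // ltW.
Qed.

(** * An invariant subspace seen by the two inner products *)

Section InvariantSubspace.
Variables (R : realType) (s : scalar_kind).
Local Notation K := (scalars R s).
Local Notation theta := (conjugation R s).
Local Notation iota := (of_real R s).
Variables (H : vectType K) (dot : {dot H for theta}) (X Y : {vspace H}).
Variables (A : 'End(H)) (hA : hermitian_op dot A) (pA : posdef_op dot A).
Hypothesis invX : (A @: X <= X)%VS.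
Local Notation dotA := (opdot hA pA).
Local Notation k := (\dim X).

Lemma opdotE x y : dotA x y = dot x (A y).
Proof. by []. Qed.

Lemma posdef_inj x : A x = 0 -> x = 0.
Proof.
move=> Ax; apply: contra_eq Ax => x0; apply: contraTneq (pA x0) => ->.
by rewrite linear0r ltxx.
Qed.

Lemma mem_invX x : x \in X -> A x \in X.
Proof. by move=> xX; apply/(subvP invX)/memv_img. Qed.

(** Positive definiteness makes [A] injective, so invariance is an equality by dimension. Every
    vector of [X] is then some [A x] with [x] in [X]. *)
Lemma invX_img : (A @: X)%VS = X.
Proof.
apply/eqP; rewrite eqEdim invX limg_dim_eq ?leqnn //.
apply/eqP; rewrite -subv0; apply/subvP => x; rewrite memv_cap memv_ker memv0.
by move=> /andP[_ /eqP/posdef_inj ->].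
Qed.

(* [X] has the same orthogonal complement for both inner products. *)
Lemma opdot_orth w : (forall y, y \in X -> dotA w y = 0) ->
  forall y, y \in X -> dot w y = 0.
Proof. by move=> wX y; rewrite -{1}invX_img => /memv_imgP[x xX ->]; exact: wX. Qed.

(** This carries the angle hypothesis from [dot] to [dotA]. If [c i = 0], the [dotA]-projection of
    [u i] onto [Y] vanishes, so [A (u i)] lies in [X] and is [dot]-orthogonal to [Y]. The hypothesis
    then forces it to be 0, against [u i] having unit length. *)
Lemma cos_Theta_opdot_gt0 (u : 'I_k -> subvs_of X) (c : 'I_k -> R) i :
  (forall i : 'I_k, (Theta iota dot X Y)`_i < pi / 2) ->
  orthonormal_family (subdot dotA X) u ->
  (forall i, oproj dotA X (oproj dotA Y (vsval (u i))) =
             iota (c i) *: vsval (u i)) -> 0 <= c i -> 0 < c i.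
Proof.
move=> ThetaXY ou PQu ci0; rewrite lt_neqAle ci0 andbT; apply/eqP => c0.
have [v [d [ov PQv Thv d01 _]]] := principal_vectors dot X Y.
have d0 j : d j != 0.
  by apply: contraTneq (ThetaXY j) => dj; rewrite Thv dj sqrtr0 acos0 ltxx.
(* Pairing [x] with the image of [v j] under both projectors gives 0, and also [d j] times the
   coordinate of [x] along [v j]; as [d j] is nonzero, all coordinates vanish. *)
have XY0 x : x \in X -> (forall y, y \in Y -> dot x y = 0) -> x = 0.
  move=> xX xY; have Qx0 : oproj dot Y x = 0.
    by apply/eqP; rewrite -(dot_eq0 dot) dot_oprojl ?oproj_mem // xY ?oproj_mem.
  have vX j : vsval (v j) \in X by exact: subvsP.
  rewrite (orthonormal_expand (e := vsval \o v) ov vX erefl xX) big1 // => j _ /=.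
  suff -> : dot x (vsval (v j)) = 0 by rewrite scale0r.
  have : dot x (oproj dot X (oproj dot Y (vsval (v j)))) = 0.
    by rewrite dot_oprojr // -oproj_hermitian Qx0 linear0l.
  rewrite PQv dotZr conj_of_real => /eqP; rewrite mulf_eq0 fmorph_eq0.
  by rewrite (negPf (d0 j)) => /eqP.
have uX := subvsP (u i).
have Qu0 : oproj dotA Y (vsval (u i)) = 0.
  apply/eqP; rewrite -(dot_eq0 dotA) dot_oprojl ?oproj_mem //.
  by rewrite -(dot_oprojr _ _ uX) PQu -c0 rmorph0 scale0r linear0r.
have Au0 : A (vsval (u i)) = 0.
  apply: XY0 => [|y yY]; first exact: mem_invX.
  by rewrite hA -opdotE -(dot_oprojl _ _ yY) Qu0 linear0l.
have := ou i i; rewrite subdotE opdotE Au0 linear0r eqxx => /esym/eqP.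
by rewrite oner_eq0.
Qed.

(** The [dotA]-projections of the [u i] onto [Y] are [dotA]-orthogonal with squared norms [c i];
    dividing them by [c i] leaves squared norms [1 / c i]. *)
Lemma angle_operator (u : 'I_k -> subvs_of X) (c : 'I_k -> R) :
  orthonormal_family (subdot dotA X) u ->
  (forall i, oproj dotA X (oproj dotA Y (vsval (u i))) =
             iota (c i) *: vsval (u i)) ->
  (forall i, 0 < c i) ->
  exists T : 'Hom(subvs_of X, subvs_of Y),
    [/\ forall x, dotA (vsval (T x)) (vsval (T x)) =
          \sum_i iota (c i)^-1 *
            (subdot dotA X x (u i) * theta (subdot dotA X x (u i))) &
        forall x, dot (vsval x) (vsval x) <= dot (vsval (T x)) (vsval (T x))].
Proof.
move=> ou PQu c0.
have ic0 i : iota (c i) != 0 by rewrite fmorph_eq0 gt_eqF.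
pose w i := vsproj Y (iota (c i)^-1 *: oproj dotA Y (vsval (u i))).
have wE i : vsval (w i) = iota (c i)^-1 *: oproj dotA Y (vsval (u i)).
  by rewrite vsprojK // memvZ // oproj_mem.
have [T Tu] := orthonormal_hom w ou; exists T.
have TE x : vsval (T x) = \sum_i subdot dotA X x (u i) *: vsval (w i).
  rewrite {1}(orthonormal_expand_full x ou (dim_subvs X)) !linear_sum.
  by apply: eq_bigr => i _; rewrite /= !linearZ /= Tu.
split=> x.
  rewrite TE; apply: dot_sum_orthogonal => i j.
  rewrite !wE dotZl dotZr conj_of_real dot_oprojl ?oproj_mem //.
  rewrite -(dot_oprojr _ _ (subvsP (u i))) PQu dotZr conj_of_real -subdotE ou.
  have [->|_] := eqVneq i j; last by rewrite !mulr0 mul0r.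
  by rewrite mulr1 fmorphV mulVf // mulr1 mul1r.
(* [T x - x] is orthogonal to [X] for [dotA], hence for [dot], and Pythagoras gives the inequality
   of norms. *)
pose d := vsval (T x) - vsval x.
have dX : forall y, y \in X -> dot d y = 0.
  apply: opdot_orth => y yX.
  have wu i : dotA (vsval (w i)) y = dotA (vsval (u i)) y.
    rewrite wE dotZl -(dot_oprojl _ _ yX) PQu dotZl mulrA fmorphV mulVf //.
    by rewrite mul1r.
  have xE : vsval x = \sum_i subdot dotA X x (u i) *: vsval (u i).
    rewrite {1}(orthonormal_expand_full x ou (dim_subvs X)) linear_sum.
    by apply: eq_bigr => i _; rewrite linearZ.
  rewrite /d TE xE linearBl /= !(dot_sumZl dotA); apply/eqP.
  by rewrite subr_eq0; apply/eqP; apply: eq_bigr => i _; rewrite wu.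
have -> : vsval (T x) = vsval x + d by rewrite addrC subrK.
rewrite [leRHS]hnormDd /=; first by rewrite lerDl dot_ge0.
by apply: dot_sym0; rewrite dX ?subvsP.
Qed.

End InvariantSubspace.

(** * Ritz values on [X] and on [Y] *)

Section RayleighRitz.
Variables (R : realType) (s : scalar_kind).
Local Notation K := (scalars R s).
Local Notation theta := (conjugation R s).
Local Notation iota := (of_real R s).
Variables (H : vectType K) (dot : {dot H for theta}) (X Y : {vspace H}).
Variables (A : 'End(H)) (hA : hermitian_op dot A) (pA : posdef_op dot A).
Hypotheses (dimXY : (\dim X <= \dim Y)%N) (invX : (A @: X <= X)%VS).
Local Notation dotA := (opdot hA pA).
Local Notation k := (\dim X).
Local Notation AX := (restr (oproj dot X \o A)%VF X).
Local Notation AY := (restr (oproj dot Y \o A)%VF Y).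
Local Notation LX := (Lambda iota AX).
Local Notation LY := (smallest_entries k (Lambda iota AY)).

Lemma nth_smallest_entries n (t : seq R) i :
  (smallest_entries n t)`_i = t`_(size t - n + i).
Proof. by rewrite nth_drop. Qed.

Lemma compression_posdef (Z : {vspace H}) :
  posdef_op (subdot dot Z) (restr (oproj dot Z \o A)%VF Z).
Proof.
move=> x x0; rewrite compression_form; apply: pA.
by apply: contraNneq x0 => x0; apply/eqP/val_inj.
Qed.

Lemma ritz_gt0 (i : 'I_k) : 0 < LX`_i.
Proof.
have [e E] := Lambda_nth (dim_subvs X) (compression_hermitian hA).
exact: eigenframe_pos (compression_posdef (Z := X)) E.
Qed.

Lemma restr_invariant : restr A X = AX.
Proof.
apply/lfunP => x; apply: val_inj.
by rewrite /= vsval_compression vsval_restr ?oproj_id ?mem_invX ?subvsP.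
Qed.

(** By contiguity the left-hand side is an eigenvalue of [A] counted from the bottom, and Cauchy
    interlacing, that is, comparison along the inclusion of [Y], applies. *)
Lemma ritz_le (i : 'I_k) : contiguous_smallest iota A X -> LX`_i <= LY`_i.
Proof.
rewrite /contiguous_smallest restr_invariant => ->.
rewrite !nth_smallest_entries !(size_Lambda hA) (size_Lambda (compression_hermitian hA)).
rewrite dim_subvs.
have [eY EY] := Lambda_nth (dim_subvs Y) (compression_hermitian hA).
have [eH EH] := Lambda_nth (erefl (\dim {:H})) hA.
have kH := dimvS (subvf X); have mH := dimvS (subvf Y).
(* In the full decreasing lists the [k] smallest entries start at positions [\dim {:H} - k] and
   [\dim Y - k]. *)
have jP : (\dim {:H} - k + i < \dim {:H})%N by have := ltn_ord i; lia.
have iP : (\dim Y - k + i < \dim Y)%N by have := ltn_ord i; lia.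
have vsE x : (linfun vsval : 'Hom(subvs_of Y, H)) x = vsval x by rewrite lfunE.
rewrite -[leLHS]mul1r.
apply: (eigenvalue_comparison (T := linfun vsval) (i := Ordinal iP) (j := Ordinal jP)
  (dim_subvs Y) erefl (compression_hermitian hA) hA EY EH) => //=.
- by apply/eqP/lker0P => x y; rewrite !vsE; exact: val_inj.
- by move=> x; rewrite !vsE compression_form rmorph1 mul1r subdotE.
- by lia.
Qed.

(** This supplies the hypothesis of the truncation lemma: the operator on [X] is perturbed with
    weights [1 / c i] truncated below at [1 / c j], and compared with the Ritz operator on [Y] along
    the angle operator. *)
Lemma ritz_majorant (u : 'I_k -> subvs_of X) (c : 'I_k -> R) (j : 'I_k) :
  orthonormal_family (subdot dotA X) u ->
  (forall i, oproj dotA X (oproj dotA Y (vsval (u i))) =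
             iota (c i) *: vsval (u i)) ->
  (forall i, 0 < c i) ->
  exists b : 'I_k -> R,
  [/\ forall i : 'I_k, LY`_i <= b i,
      forall i : 'I_k, (c j)^-1 * LX`_i <= b i &
      \prod_i b i = \prod_(i < k) LX`_i * \prod_i Num.max (c i)^-1 (c j)^-1].
Proof.
move=> ou PQu c0; have hX := compression_hermitian (Z := X) hA.
have hY := compression_hermitian (Z := Y) hA.
have [eX EX] := Lambda_nth (dim_subvs X) hX.
have [eY EY] := Lambda_nth (dim_subvs Y) hY.
have dotAE x y : subdot dotA X x y = subdot dot X x (AX y).
  by rewrite compression_form.
have [B [eb [b [hB EB Bform prodb lowb]]]] := eigenframe_perturbation
  (fun i => Num.max (c i)^-1 (c j)^-1) (dim_subvs X) hX EX dotAE ou.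
have [T [Tnorm Tle]] := angle_operator invX ou PQu c0.
exists b; split=> // i; last first.
  by apply: lowb => [|l]; rewrite ?le_max ?lexx ?orbT ?invr_ge0 ?ltW.
rewrite nth_smallest_entries (size_Lambda hY) dim_subvs.
have iP : (\dim Y - k + i < \dim Y)%N by have := ltn_ord i; lia.
rewrite -[leLHS]mul1r.
apply: (eigenvalue_comparison (T := T) (i := i) (j := Ordinal iP)
  (dim_subvs X) (dim_subvs Y) hB hY EB EY) => //=.
(* [T] is injective since it does not decrease the norm. *)
- apply/eqP; rewrite -subv0; apply/subvP => x; rewrite memv_ker memv0 => /eqP Tx.
  rewrite -(dot_eq0 (subdot dot X)) subdotE eq_le dot_ge0 andbT.
  by apply: le_trans (Tle x) _; rewrite (_ : vsval (T x) = 0) ?linear0l ?Tx ?linear0.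
(* The form at [T x] has weights [1 / c i], at most the truncated ones, while the norm of [T x] is
   at least that of [x]. *)
- move=> x; rewrite rmorph1 mul1r compression_form -(opdotE hA pA) Tnorm Bform.
  apply: ler_pM; rewrite ?dot_ge0 //; last exact: Tle.
    by rewrite -Tnorm dot_ge0.
  by apply: ler_sum => l _; rewrite ler_wpM2r ?mul_conj_ge0 // of_real_le le_max lexx.
- by lia.
Qed.

End RayleighRitz.

Theorem theorem2p5 (R : realType) (s : scalar_kind)
    (H : vectType (scalars R s)) (dot : {dot H for conjugation R s})
    (X Y : {vspace H}) (A : 'End(H))
    (dimXY : (\dim X <= \dim Y)%N)
    (ThetaXY : forall i : 'I_(\dim X), (Theta (of_real R s) dot X Y)`_i < pi / 2)
    (hA : hermitian_op dot A) (pA : posdef_op dot A)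
    (invX : (A @: X <= X)%VS)
    (smallX : contiguous_smallest (of_real R s) A X) :
  let lamX (i : 'I_(\dim X)) :=
    (Lambda (of_real R s) (restr (oproj dot X \o A)%VF X))`_i in
  let lamY (i : 'I_(\dim X)) :=
    (smallest_entries (\dim X)
       (Lambda (of_real R s) (restr (oproj dot Y \o A)%VF Y)))`_i in
  let thetaA (i : 'I_(\dim X)) :=
    (Theta (of_real R s) (opdot hA pA) X Y)`_i in
  [/\ (* the maximum starts from 0, a lower bound of every component *)
      forall i, 0 <= 1 - lamX i / lamY i
                  <= \big[Num.max/0]_j sin (thetaA j) ^+ 2,
      (forall i, 0 <= ln (lamY i / lamX i)) /\
      weak_majorized (fun i => ln (lamY i / lamX i))
                     (fun i => ln (1 + tan (thetaA i) ^+ 2)) &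
      (forall i, 0 <= lamY i / lamX i - 1) /\
      weak_majorized (fun i => lamY i / lamX i - 1)
                     (fun i => tan (thetaA i) ^+ 2)].
Proof.
move=> lamX lamY thetaA.
have lamX0 i : 0 < lamX i by exact: ritz_gt0 hA pA i.
have lam_le i : lamX i <= lamY i by exact: ritz_le hA dimXY invX i smallX.
have lamY0 i : 0 < lamY i by exact: lt_le_trans (lam_le i).
have [u [c [ou PQu Th c01 cS]]] := principal_vectors (opdot hA pA) X Y.
(* The angle hypothesis enters here: it keeps the [dotA]-angles off [pi / 2], where [tan] takes only
   a default value. *)
have c0 i : 0 < c i.
  have /andP[ci0 _] := c01 i.
  exact: (cos_Theta_opdot_gt0 (hA := hA) (pA := pA) invX ThetaXY ou PQu).
have c1 i : 0 < c i <= 1 by have /andP[_ ->] := c01 i; rewrite c0.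
have tanE i : 1 + tan (thetaA i) ^+ 2 = (c i)^-1 by rewrite /thetaA Th tan_acos_sqrt.
have maj_ln : weak_majorized (fun i => ln (lamY i / lamX i))
                          (fun i => ln (1 + tan (thetaA i) ^+ 2)).
  have -> : (fun i => ln (1 + tan (thetaA i) ^+ 2)) = (fun i => ln (c i)^-1).
    by apply/funext => i; rewrite tanE.
  apply: weak_majorized_ln => // [i|i j ij|j]; first by rewrite invr_gt0.
    by rewrite lef_pV2 ?posrE ?cS.
  exact: (ritz_majorant (hA := hA) (pA := pA) dimXY invX j ou PQu c0).
have ratio_gt0 i : 0 < lamY i / lamX i by rewrite divr_gt0.
have ratio_ge1 i : 1 <= lamY i / lamX i by rewrite ler_pdivlMr ?mul1r.
split; [move=> i | split=> // i | split=> [i|]]; last 1 first.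
- have := weak_majorized_exp maj_ln.
  have -> : (fun i => expR (ln (lamY i / lamX i)) - 1) = (fun i => lamY i / lamX i - 1).
    by apply/funext => i; rewrite lnK ?posrE.
  have -> : (fun i => expR (ln (1 + tan (thetaA i) ^+ 2)) - 1) =
            (fun i => tan (thetaA i) ^+ 2).
    by apply/funext => i; rewrite lnK ?posrE ?tanE ?invr_gt0 // -tanE addrC addKr.
  by [].
- rewrite subr_ge0 ler_pdivrMr // mul1r lam_le /=.
  (* The index 0 carries the largest angle, and the first partial sum of [maj_ln] bounds every
     ratio. *)
  pose o := Ordinal (leq_ltn_trans (leq0n i) (ltn_ord i)).
  have : ln (lamY i / lamX i) <= ln (c o)^-1.
    have := maj_ln 1%N; rewrite (leq_ltn_trans (leq0n i) (ltn_ord i)) => /(_ isT).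
    rewrite !big_ord1; move/(le_trans (le_decreasing0 _ i)) => /le_trans; apply.
    rewrite decreasing_id => [|i' j' ij].
      by rewrite (codom_nth _ 0 o) tanE.
    by rewrite !tanE ler_ln ?posrE ?invr_gt0 // lef_pV2 ?posrE ?cS.
  (* Inverting gives [c o <= lamX i / lamY i], and [1 - c o] is the squared sine at [o]. *)
  rewrite ler_ln ?posrE ?invr_gt0 // -(lef_pV2 (x := (c o)^-1)) ?posrE ?invr_gt0 //.
  rewrite invrK invf_div => co.
  apply: (le_trans (_ : _ <= sin (thetaA o) ^+ 2)); last exact: le_bigmax.
  by rewrite /thetaA Th sin_acos_sqrt ?c01 // lerB.
- by rewrite ln_ge0.
- by rewrite subr_ge0.
Qed.
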